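(* Let $C$ be an algebraically closed field of characteristic zero and let $R$ be a complete local noetherian $C$-algebra with residue field $C$. Let $(M,\nabla)$ be an object of $\mathbf{MC}(R((x))/R)$. Then $M$ is flat as an $R((x))$-module if and only if $M$ is flat as an $R$-module.
   Context: $R((x))=R[[x]][x^{-1}]$ and $\vartheta(\sum a_nx^n)=\sum na_nx^n$. $\mathbf{MC}(R((x))/R)$ is the category of pairs $(M,\nabla)$ with $M$ a finitely generated $R((x))$-module and $\nabla:M\to M$ an $R$-linear map with $\nabla(fm)=\vartheta(f)m+f\nabla(m)$ for $f\in R((x))$, $m\in M$. *)

(* Defs.v *)
From HB Require Import structures.
From mathcomp Require Import all_boot all_order all_algebra.
From mathcomp Require Import boolp classical_sets functions fsbigop.
From mathcomp Require Import freeg.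
From mathcomp Require Import zify.

Set Implicit Arguments.
Unset Strict Implicit.
Unset Printing Implicit Defensive.

Import Order.TTheory GRing.Theory Num.Theory.

Local Open Scope classical_set_scope.
Local Open Scope ring_scope.
Local Open Scope quotient_scope.

(* A Laurent series sum_n f_n x^n is its coefficient family f : int -> R, which
   must vanish in all sufficiently negative degrees; this is R[[x]][x^-1], see
   [laurentE]. *)
Section LaurentZmod.
Variable R : zmodType.

Definition bounded_below : {pred int -> R} :=
  fun f => `[< exists N : int, forall n, n < N -> f n = 0 >].

Lemma bounded_belowP (f : int -> R) :
  reflect (exists N : int, forall n, n < N -> f n = 0) (f \in bounded_below).
Proof. exact: asboolP. Qed.

Fact bounded_below_zmod_closed : zmod_closed bounded_below.
Proof.
split; first by apply/bounded_belowP; exists 0.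
move=> f g /bounded_belowP [a Ha] /bounded_belowP [b Hb].
apply/bounded_belowP; exists (Num.min a b) => n; rewrite lt_min => /andP [na nb].
have -> : (f - g) n = f n - g n by [].
by rewrite Ha ?Hb ?subr0.
Qed.
HB.instance Definition _ :=
  GRing.isZmodClosed.Build (int -> R) bounded_below bounded_below_zmod_closed.

Record laurent := Laurent {
  lcoef :> int -> R;
  lcoef_bounded_below : lcoef \in bounded_below }.

HB.instance Definition _ := [isSub for lcoef].
HB.instance Definition _ := [Choice of laurent by <:].
HB.instance Definition _ := [SubChoice_isSubZmodule of laurent by <:].

Lemma laurentP (f g : laurent) : (forall n, f n = g n) -> f = g.
Proof. by move=> fg; apply/val_inj/funext. Qed.

Lemma laurent_bound (f : laurent) : exists N : int, forall n, n < N -> f n = 0.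
Proof. exact/bounded_belowP/(valP f). Qed.

Lemma lcoef0 n : (0 : laurent) n = 0. Proof. by []. Qed.
Lemma lcoefD (f g : laurent) n : (f + g) n = f n + g n. Proof. by []. Qed.
Lemma lcoefN (f : laurent) n : (- f) n = - f n. Proof. by []. Qed.

End LaurentZmod.

Section LaurentRing.
Variable R : comNzRingType.
Implicit Types f g h : laurent R.

Definition mul_coef f g (n : int) : R := \sum_(i \in [set: int]) f i * g (n - i).

Let trunc f (a : int) k : {poly R} := \poly_(i < k) f (a + i%:Z).

Lemma mul_coef_lt f g a b n :
    (forall i, i < a -> f i = 0) -> (forall i, i < b -> g i = 0) ->
  n < a + b -> mul_coef f g n = 0.
Proof.
move=> Ha Hb nab; apply: fsbig1 => i _; case: (ltP i a) => ia.
  by rewrite Ha ?mul0r.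
by rewrite Hb ?mulr0 //; lia.
Qed.

Lemma mul_coef_ge f g a b (j k : nat) :
    (forall i, i < a -> f i = 0) -> (forall i, i < b -> g i = 0) ->
  (j < k)%N -> mul_coef f g (a + b + j%:Z) = (trunc f a k * trunc g b k)`_j.
Proof.
move=> Ha Hb jk; rewrite coefM /mul_coef.
pose s := [seq a + i%:Z | i <- iota 0 j.+1].
have us : uniq s by rewrite map_inj_uniq ?iota_uniq // => x y; lia.
rewrite -(@fsbig_widen _ _ _ _ [set` s]) //; last first.
  move=> i [_ /= nis]; case: (ltP i a) => ia; first by rewrite Ha ?mul0r.
  rewrite Hb ?mulr0 //; apply: contra_notT nis => H.
  apply/mapP; exists `|i - a|%N; last by lia.
  by rewrite mem_iota; lia.
rewrite -fsbig_seq // big_map -[iota 0 j.+1]/(index_iota 0 j.+1) big_mkord; apply: eq_bigr => i _.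
have := ltn_ord i; rewrite ltnS => ij.
rewrite !coef_poly ifT ?ifT; [|lia|lia].
by congr (_ * lcoef g _); lia.
Qed.

Fact mul_coef_bounded_below f g : mul_coef f g \in @bounded_below R.
Proof.
have [a Ha] := laurent_bound f; have [b Hb] := laurent_bound g.
by apply/bounded_belowP; exists (a + b) => n; apply: mul_coef_lt.
Qed.

Definition lmul f g : laurent R := Laurent (mul_coef_bounded_below f g).

Definition laurentC_coef (c : R) (n : int) : R := if n == 0 then c else 0.

Fact laurentC_bounded_below c : laurentC_coef c \in @bounded_below R.
Proof.
by apply/bounded_belowP; exists 0 => n n0; rewrite /laurentC_coef ifN //; lia.
Qed.

Definition laurentC c : laurent R := Laurent (laurentC_bounded_below c).

Let split_ge (a n : int) : a <= n -> exists k : nat, n = a + k%:Z.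
Proof. by move=> an; exists `|n - a|%N; lia. Qed.

Fact lmulA : associative lmul.
Proof.
move=> f g h.
have [a Ha] := laurent_bound f; have [b Hb] := laurent_bound g.
have [c Hc] := laurent_bound h.
have Hab i : i < a + b -> lmul f g i = 0 by apply: mul_coef_lt.
have Hbc i : i < b + c -> lmul g h i = 0 by apply: mul_coef_lt.
apply: laurentP => n; case: (ltP n (a + (b + c))) => Hn.
  by rewrite [LHS](mul_coef_lt Ha Hbc) ?[RHS](mul_coef_lt Hab Hc) // -addrA.
have [k ->] := split_ge Hn.
rewrite [LHS](mul_coef_ge Ha Hbc (ltnSn k)).
rewrite addrA [RHS](mul_coef_ge Hab Hc (ltnSn k)).
transitivity (trunc f a k.+1 * (trunc g b k.+1 * trunc h c k.+1))`_k.
  rewrite !coefM; apply: eq_bigr => i _; congr (_ * _).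
  have ik := ltn_ord i; rewrite coef_poly ifT; last by lia.
  by apply: mul_coef_ge => //; lia.
rewrite mulrA !coefM; apply: eq_bigr => i _; congr (_ * _).
have ik := ltn_ord i; rewrite [RHS]coef_poly ifT //.
by rewrite [RHS](@mul_coef_ge f g a b i k.+1).
Qed.

Fact lmulC : commutative lmul.
Proof.
move=> f g; have [a Ha] := laurent_bound f; have [b Hb] := laurent_bound g.
apply: laurentP => n; case: (ltP n (a + b)) => Hn.
  by rewrite [LHS](mul_coef_lt Ha Hb) ?[RHS](mul_coef_lt Hb Ha) // addrC.
have [k ->] := split_ge Hn.
rewrite [LHS](mul_coef_ge Ha Hb (ltnSn k)) mulrC.
by rewrite [a + b]addrC [RHS](mul_coef_ge Hb Ha (ltnSn k)).
Qed.

Lemma lcoefCM c f n : lmul (laurentC c) f n = c * f n.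
Proof.
rewrite /lmul /= /mul_coef -(@fsbig_widen _ _ _ _ [set 0]) //.
  by rewrite fsbig_set1 /= /laurentC_coef eqxx subr0.
by move=> i [_ /= /eqP /negbTE i0]; rewrite /= /laurentC_coef i0 mul0r.
Qed.

Fact lmul1 : left_id (laurentC 1) lmul.
Proof. by move=> f; apply: laurentP => n; rewrite lcoefCM mul1r. Qed.

Fact lmulDl : left_distributive lmul +%R.
Proof.
move=> f g h; have [a Ha] := laurent_bound f; have [b Hb] := laurent_bound g.
have [c Hc] := laurent_bound h; pose d := Num.min a b.
have Hf i : i < d -> f i = 0 by rewrite lt_min => /andP [/Ha].
have Hg i : i < d -> g i = 0 by rewrite lt_min => /andP [_ /Hb].
have Hfg i : i < d -> (f + g) i = 0.
  by move=> id; rewrite lcoefD Hf ?Hg ?addr0.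
apply: laurentP => n; rewrite lcoefD; case: (ltP n (d + c)) => Hn.
  by rewrite /= !(@mul_coef_lt _ _ d c) ?addr0.
have [k ->] := split_ge Hn.
have truncD : trunc (f + g) d k.+1 = trunc f d k.+1 + trunc g d k.+1.
  apply/polyP => i; rewrite coefD !coef_poly.
  by case: ifP => _; rewrite ?lcoefD ?addr0.
by rewrite /= !(@mul_coef_ge _ _ d c k k.+1) // truncD mulrDl coefD.
Qed.

Fact laurent1_neq0 : laurentC 1 != 0.
Proof.
apply/eqP => /(congr1 (fun f : laurent R => f 0)).
by rewrite /= /laurentC_coef eqxx => /eqP; rewrite oner_eq0.
Qed.

HB.instance Definition _ := GRing.Zmodule_isComNzRing.Build (laurent R)
  lmulA lmulC lmul1 lmulDl laurent1_neq0.

Lemma lcoefM f g n : (f * g) n = \sum_(i \in [set: int]) f i * g (n - i).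
Proof. by []. Qed.

Fact laurentC_is_zmod_morphism : zmod_morphism laurentC.
Proof.
move=> c d; apply: laurentP => n; rewrite lcoefD lcoefN /= /laurentC_coef.
by case: eqP; rewrite ?subr0.
Qed.

Fact laurentC_is_monoid_morphism : monoid_morphism laurentC.
Proof.
split=> // c d; apply: laurentP => n; rewrite [RHS]lcoefCM /= /laurentC_coef.
by case: eqP; rewrite ?mulr0.
Qed.

HB.instance Definition _ := GRing.isZmodMorphism.Build R (laurent R) laurentC
  laurentC_is_zmod_morphism.
HB.instance Definition _ := GRing.isMonoidMorphism.Build R (laurent R) laurentC
  laurentC_is_monoid_morphism.

Fact xpow_bounded_below (k : int) :
  (fun n : int => if n == k then 1 else 0 : R) \in @bounded_below R.
Proof.
by apply/bounded_belowP; exists k => n nk; rewrite ifN //; lia.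
Qed.

Definition xpow (k : int) : laurent R := Laurent (xpow_bounded_below k).

Lemma lcoefXM k f n : (xpow k * f) n = f (n - k).
Proof.
rewrite lcoefM -(@fsbig_widen _ _ _ _ [set k]) //.
  by rewrite fsbig_set1 /= eqxx mul1r.
by move=> i [_ /= /eqP /negbTE ik]; rewrite ik mul0r.
Qed.

Lemma laurentE f : exists (k : nat) (p : laurent R),
  (forall n, n < 0 -> p n = 0) /\ xpow 1 ^+ k * f = p.
Proof.
have [a Ha] := laurent_bound f.
exists `|a|%N, (xpow 1 ^+ `|a|%N * f); split=> // n n0.
have E k : forall h m, (xpow 1 ^+ k * h) m = h (m - k%:Z).
  elim: k => [|k IH] h m; first by rewrite expr0 mul1r subr0.
  by rewrite exprSr -mulrA IH lcoefXM; congr (lcoef h _); lia.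
by rewrite E Ha //; lia.
Qed.

Lemma xpowV : xpow 1 * xpow (-1) = 1.
Proof.
by apply: laurentP => n; rewrite lcoefXM /= /laurentC_coef subr_eq addNr.
Qed.

Fact theta_bounded_below f : (fun n : int => f n *~ n) \in @bounded_below R.
Proof.
have [a Ha] := laurent_bound f.
by apply/bounded_belowP; exists a => n /Ha ->; rewrite mul0rz.
Qed.

Definition theta f : laurent R := Laurent (theta_bounded_below f).

End LaurentRing.

Definition restrict (A B : comNzRingType) (phi : {rmorphism A -> B})
  (M : lmodType B) : Type := M.

Section Restrict.
Variables (A B : comNzRingType) (phi : {rmorphism A -> B}) (M : lmodType B).

HB.instance Definition _ := GRing.Zmodule.copy (restrict phi M) M.

Let rscale (a : A) (m : restrict phi M) : restrict phi M := phi a *: (m : M).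

Fact rscaleA a b m : rscale a (rscale b m) = rscale (a * b) m.
Proof. by rewrite /rscale scalerA rmorphM. Qed.
Fact rscale1 : left_id 1 rscale.
Proof. by move=> m; rewrite /rscale rmorph1 scale1r. Qed.
Fact rscaleDr : right_distributive rscale +%R.
Proof. by move=> a m n; rewrite /rscale scalerDr. Qed.
Fact rscaleDl m : {morph rscale^~ m : a b / a + b}.
Proof. by move=> a b; rewrite /rscale rmorphD scalerDl. Qed.

HB.instance Definition _ := GRing.Zmodule_isLmodule.Build A (restrict phi M)
  rscaleA rscale1 rscaleDr rscaleDl.

Lemma restrict_scaleE (a : A) (m : restrict phi M) :
  a *: m = phi a *: (m : M) :> M.
Proof. by []. Qed.

End Restrict.

(* The tensor product over A, as an abelian group: the free abelian group on
   N * M modulo the subgroup generated by the usual relations. *)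
Section Tensor.
Variables (A : comNzRingType) (N M : lmodType A).

Inductive tensor_relation : {freeg (N * M)%type} -> Prop :=
| TensorDl n n' m :
    tensor_relation (<< (n + n', m) >> - << (n, m) >> - << (n', m) >>)
| TensorDr n m m' :
    tensor_relation (<< (n, m + m') >> - << (n, m) >> - << (n, m') >>)
| TensorZ a n m :
    tensor_relation (<< (a *: n, m) >> - << (n, a *: m) >>)
| Tensor0 : tensor_relation 0
| TensorB x y :
    tensor_relation x -> tensor_relation y -> tensor_relation (x - y).

Definition tensor_rel : {pred {freeg (N * M)%type}} :=
  fun x => `[< tensor_relation x >].

Fact tensor_rel_zmod_closed : zmod_closed tensor_rel.
Proof.
split; first exact/asboolP/Tensor0.
by move=> x y /asboolP xr /asboolP yr; apply/asboolP/TensorB.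
Qed.
HB.instance Definition _ :=
  GRing.isZmodClosed.Build {freeg (N * M)%type} tensor_rel
    tensor_rel_zmod_closed.

Definition tensor : zmodType := Quotient.quot tensor_rel.

Definition tens (n : N) (m : M) : tensor :=
  \pi_(Quotient.quot tensor_rel) << (n, m) >>.

Lemma tensDl n n' m : tens (n + n') m = tens n m + tens n' m.
Proof.
rewrite /tens -[RHS]raddfD /=; apply/eqP; rewrite -Quotient.idealrBE opprD addrA.
exact/asboolP/TensorDl.
Qed.

Lemma tensDr n m m' : tens n (m + m') = tens n m + tens n m'.
Proof.
rewrite /tens -[RHS]raddfD /=; apply/eqP; rewrite -Quotient.idealrBE opprD addrA.
exact/asboolP/TensorDr.
Qed.

Lemma tensZ a n m : tens (a *: n) m = tens n (a *: m).
Proof.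
by rewrite /tens; apply/eqP; rewrite -Quotient.idealrBE; apply/asboolP/TensorZ.
Qed.

(* The universal property: [tensor_lift b] is meaningful for [balanced b]. *)
Section Lift.
Variables (V : zmodType) (b : N -> M -> V).

Definition balanced :=
  [/\ forall n n' m, b (n + n') m = b n m + b n' m,
      forall n m m', b n (m + m') = b n m + b n m' &
      forall a n m, b (a *: n) m = b n (a *: m)].

Let lift : {freeg (N * M)%type} -> V :=
  fglift (fun p : N * M => b p.1 p.2 : zmodule V).

Definition tensor_lift (z : tensor) : V := lift (repr z).

Let liftU n m : lift << (n, m) >> = b n m.
Proof. by rewrite /lift liftU scale1r. Qed.

Let liftB x y : lift (x - y) = lift x - lift y.
Proof.
exact: (lift_is_additive (fun p : N * M => b p.1 p.2 : zmodule V) x y).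
Qed.

Hypothesis bP : balanced.

Let lift_rel x : tensor_relation x -> lift x = 0.
Proof.
have [bDl bDr bZ] := bP.
elim=> [n n' m|n m m'|a n m||{}x y _ x0 _ y0]; rewrite ?liftB ?liftU.
- by rewrite bDl -addrA -opprD subrr.
- by rewrite bDr -addrA -opprD subrr.
- by rewrite bZ subrr.
- by rewrite -[X in lift X](subrr 0) liftB subrr.
- by rewrite x0 y0 subrr.
Qed.

Let tensor_lift_pi x : tensor_lift (\pi_(Quotient.quot tensor_rel) x) = lift x.
Proof.
apply/eqP; rewrite -subr_eq0 -liftB; apply/eqP/lift_rel/asboolP.
rewrite -[is_true _]/(is_true (_ \in tensor_rel)).
by rewrite Quotient.idealrBE reprK.
Qed.

Lemma tensor_lift_tens n m : tensor_lift (tens n m) = b n m.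
Proof. by rewrite tensor_lift_pi liftU. Qed.

Lemma tensor_lift_zmod : zmod_morphism tensor_lift.
Proof.
move=> x y; rewrite -[x]reprK -[y]reprK -[X in tensor_lift X]raddfB.
by rewrite !tensor_lift_pi liftB.
Qed.

End Lift.

Lemma tensor_ind (P : tensor -> Prop) :
    (forall n m, P (tens n m)) -> (forall x y, P x -> P y -> P (x - y)) ->
  forall z, P z.
Proof.
move=> Pt PB z; rewrite -[z]reprK; move: (repr z) => D.
have P0 : P 0 by rewrite -(subrr (tens 0 0)); apply: PB.
have PN x : P x -> P (- x) by move=> Px; rewrite -sub0r; apply: PB.
have PD x y : P x -> P y -> P (x + y).
  by move=> Px Py; rewrite -[y]opprK; apply: PB => //; apply: PN.
have PM x k : P x -> P (x *~ k).
  move=> Px; have PMn j : P (x *+ j).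
    by elim: j => [//|j IH]; rewrite mulrS; apply: PD.
  by case: k => j; [apply: PMn | apply/PN/PMn].
elim/freeg_ind_dom0: D => [|k [n m] D _ _ PDD].
  by rewrite raddf0.
rewrite raddfD; apply: PD => //=.
by rewrite -[k]intz -freegU_mulz raddfMz; apply/PM/Pt.
Qed.

End Tensor.

Definition tensor_map (A : comNzRingType) (N N' M : lmodType A)
    (f : {linear N -> N'}) : tensor N M -> tensor N' M :=
  tensor_lift (fun n m => tens (f n) m).

Lemma tensor_map_balanced (A : comNzRingType) (N N' M : lmodType A)
  (f : {linear N -> N'}) : balanced (fun n (m : M) => tens (f n) m).
Proof.
split=> *; by rewrite ?raddfD /= ?tensDl ?tensDr // linearZ /= tensZ.
Qed.

Lemma tensor_map_tens (A : comNzRingType) (N N' M : lmodType A)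
  (f : {linear N -> N'}) n (m : M) : tensor_map f (tens n m) = tens (f n) m.
Proof. by rewrite /tensor_map tensor_lift_tens //; apply: tensor_map_balanced. Qed.

Definition flat (A : comNzRingType) (M : lmodType A) : Prop :=
  forall (N N' : lmodType A) (f : {linear N -> N'}),
    injective f -> injective (@tensor_map A N N' M f).

Definition finitely_generated (A : comNzRingType) (M : lmodType A) : Prop :=
  exists s : seq M, forall m : M,
    exists c : 'I_(size s) -> A, m = \sum_(i < size s) c i *: s`_i.

Record MC (R : comNzRingType) := {
  MC_module : lmodType (laurent R);
  MC_nabla : MC_module -> MC_module;
  MC_fg : finitely_generated MC_module;
  MC_linear :
    linear (MC_nabla : restrict (@laurentC R) MC_module ->
                       restrict (@laurentC R) MC_module);
  MC_leibniz : forall (f : laurent R) (m : MC_module),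
    MC_nabla (f *: m) = theta f *: m + f *: MC_nabla m }.

Section Ideals.
Variable R : comNzRingType.
Implicit Types (I S m : set R).

Definition is_ideal I : Prop :=
  [/\ I 0, forall a b, I a -> I b -> I (a + b) & forall a b, I b -> I (a * b)].

Definition generated_ideal S : set R :=
  [set r | exists2 s : seq (R * R),
     forall p, p \in s -> S p.2 & r = \sum_(p <- s) p.1 * p.2].

Definition noetherian : Prop :=
  forall I, is_ideal I -> exists s : seq R, I = generated_ideal [set` s].

Definition maximal_ideal m : Prop :=
  [/\ is_ideal m, m <> setT &
      forall I, is_ideal I -> m `<=` I -> I = m \/ I = setT].

Definition local_ring m : Prop :=
  maximal_ideal m /\ forall m', maximal_ideal m' -> m' = m.

Definition ideal_pow I n : set R :=
  generated_ideal
    [set \prod_(i < n) a i | a in [set a : 'I_n -> R | forall i, I (a i)]].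

(* R -> lim_n R/m^n is bijective; a point of the limit is given by a sequence
   of representatives of its components. *)
Definition complete_ring m : Prop :=
  forall u : nat -> R, (forall n, ideal_pow m n (u n.+1 - u n)) ->
    exists! l : R, forall n, ideal_pow m n (l - u n).

End Ideals.

(* C -> R -> R/m is bijective. *)
Definition residue_field_is (C : fieldType) (R : comAlgType C) (m : set R) : Prop :=
  forall r : R, exists! c : C, m (r - c%:A).

(* Main.v *)
From HB Require Import structures.
From mathcomp Require Import all_boot all_order all_algebra.
From mathcomp Require Import boolp classical_sets functions fsbigop.
From mathcomp Require Import freeg.
From mathcomp Require Import zify ring.
Require Import Defs.

Set Implicit Arguments.
Unset Strict Implicit.
Unset Printing Implicit Defensive.

Import Order.TTheory GRing.Theory Num.Theory.
Local Open Scope ring_scope.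

(** Write A = R((x)) and let V be the A-module underlying M.

    Flatness is used through its equational form ([flat_equational],
    [equational_flat]): every linear relation among elements of the module
    comes from relations among scalars.

    Flat over A implies flat over R because A is flat over R.  A relation over
    R among elements of V comes from vectors of Laurent series that solve a
    linear equation with coefficients in R.  Such a vector solves it
    coefficient by coefficient, and since the solutions in R^n are finitely
    generated, it is an A-combination of finitely many solutions in R^n
    ([laurent_decompose], [noetherian_submodule], [equational_restrict]).

    For the converse, let I be the ideal of those f in A for which
    multiplication by f on V factors through a finite free module, that is,
    has the form v |-> sum_i h_i(v) e_i with linear forms h_i.  If 1 is in I
    then V is a direct summand of a free module.

    The connection makes I stable under theta: the commutator of nabla with
    such a sum is again such a sum, and the commutator of nabla with f is
    theta(f) ([finite_rank_commutator]).  Now suppose that I contains some f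
    whose constant coefficient is a unit.  The operator theta + k multiplies
    the coefficient of x^n by n + k, so finitely many of them kill the negative
    coefficients of f and, in characteristic zero, keep the constant one a
    unit.  What remains is an invertible power series, whence 1 is in I
    ([finite_rank_id]).

    Flatness over R provides such an f, congruent to 1 modulo m.  Lift a basis
    of V/mV over the field (R/m)((x)) to e_1, ..., e_r in V
    ([minimal_generators]).  Nakayama's lemma gives s = 1 modulo m with sV
    contained in the span of the e_i ([nakayama]).  The e_i are linearly
    independent: by flatness over R, s times a relation is a combination of
    relations with coefficients in m, so the coefficients of any relation lie
    in every power of m, and these powers meet in 0 because R is complete
    ([lifted_free]).  The coordinates of s v are therefore linear in v, and s
    is in I ([generically_free]). *)

(** * The equational criterion for flatness *)

(** A relation between the [m i] is trivial when it follows from relations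
    between scalars.  This form of flatness mentions no tensor product, so a
    change of base ring becomes a manipulation of coefficient families. *)
Definition equational (A : comNzRingType) (M : lmodType A) : Prop :=
  forall (I : finType) (a : I -> A) (m : I -> M), \sum_i a i *: m i = 0 ->
  exists (J : finType) (b : I -> J -> A) (y : J -> M),
    (forall i, m i = \sum_j b i j *: y j) /\
    (forall j, \sum_i a i * b i j = 0).

Section TensorRelations.
Variables (A : comNzRingType) (N M : lmodType A).

Lemma tens0l (m : M) : tens (0 : N) m = 0.
Proof. by apply: (addrI (tens 0 m)); rewrite -tensDl !addr0. Qed.

Lemma tensNl (n : N) (m : M) : tens (- n) m = - tens n m.
Proof. by apply/eqP; rewrite -addr_eq0 -tensDl addNr tens0l. Qed.

Lemma tens_sumr (I : finType) (n : N) (f : I -> M) :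
  tens n (\sum_i f i) = \sum_i tens n (f i).
Proof.
apply: (big_morph (fun m => tens n m)) => [m m'|]; first exact: tensDr.
by apply: (addrI (tens n 0)); rewrite -tensDr !addr0.
Qed.

Lemma tensor_sum (z : tensor N M) :
  exists s : seq (N * M), z = \sum_(p <- s) tens p.1 p.2.
Proof.
elim/tensor_ind: z => [n m|x y [s ->] [t ->]].
  by exists [:: (n, m)]; rewrite big_seq1.
exists (s ++ [seq (- p.1, p.2) | p <- t]); rewrite big_cat big_map -sumrN.
by congr (_ + _); apply: eq_bigr => p _; rewrite tensNl.
Qed.

(** The universal property of the tensor product for maps that are balanced
    modulo a subgroup [W], without forming the quotient by [W]. *)
Lemma tensor_sum_eq0 (V : zmodType) (W : V -> Prop) (b : N -> M -> V) :
    W 0 -> (forall x y, W x -> W y -> W (x - y)) ->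
    (forall n n' m, W (b (n + n') m - b n m - b n' m)) ->
    (forall n m m', W (b n (m + m') - b n m - b n m')) ->
    (forall a n m, W (b (a *: n) m - b n (a *: m))) ->
  forall s : seq (N * M),
  \sum_(p <- s) tens p.1 p.2 = 0 -> W (\sum_(p <- s) b p.1 p.2).
Proof.
move=> W0 WB WDl WDr WZ s s0.
pose lift := fglift (fun p : N * M => b p.1 p.2 : zmodule V).
have liftU n m : lift << (n, m) >> = b n m by rewrite /lift liftU scale1r.
have liftB x y : lift (x - y) = lift x - lift y.
  exact: (lift_is_additive (fun p : N * M => b p.1 p.2 : zmodule V) x y).
have lift0 : lift 0 = 0 by rewrite -(subrr 0) liftB subrr.
have liftD x y : lift (x + y) = lift x + lift y.
  by rewrite -[y in LHS]opprK -[- y]sub0r !liftB lift0 sub0r opprK.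
have lift_rel x : tensor_relation x -> W (lift x).
  elim=> [n n' m|n m m'|a n m||{}x y _ Wx _ Wy];
    by rewrite ?liftB ?liftU ?lift0 //; apply: WB.
have -> : \sum_(p <- s) b p.1 p.2 = lift (\sum_(p <- s) << p >>).
  by rewrite (big_morph lift liftD lift0); apply: eq_bigr => -[n m] _.
apply/lift_rel/asboolP.
rewrite -[is_true _]/(is_true (_ \in @tensor_rel A N M)).
rewrite -[X in X \in _]subr0 Quotient.idealrBE raddf0 raddf_sum /=.
by rewrite -[X in _ == X]s0; apply/eqP/eq_bigr => -[n m].
Qed.

End TensorRelations.

Section IdealOf.
Variables (A : comNzRingType) (I : finType) (a : I -> A).

Definition in_ideal_of : {pred A^o} :=
  fun x => `[< exists c : I -> A, x = \sum_i c i * a i >].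

Fact in_ideal_of_closed : submod_closed in_ideal_of.
Proof.
split.
  by apply/asboolP; exists (fun=> 0); rewrite big1 // => i _; rewrite mul0r.
move=> k x y /asboolP [c ->] /asboolP [d ->]; apply/asboolP.
exists (fun i => k * c i + d i); rewrite scaler_sumr -big_split /=.
by apply: eq_bigr => i _; rewrite mulrDl -mulrA.
Qed.
HB.instance Definition _ :=
  GRing.isSubmodClosed.Build A A^o in_ideal_of in_ideal_of_closed.

Record ideal_of := IdealOf { ideal_val : A^o; _ : ideal_val \in in_ideal_of }.
HB.instance Definition _ := [isSub for ideal_val].
HB.instance Definition _ := [Choice of ideal_of by <:].
HB.instance Definition _ := [SubChoice_isSubLmodule of ideal_of by <:].

End IdealOf.

Lemma tensor_map0 (A : comNzRingType) (N N' M : lmodType A)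
    (f : {linear N -> N'}) :
  tensor_map f 0 = 0 :> tensor N' M.
Proof.
have fB := tensor_lift_zmod (tensor_map_balanced M f).
by rewrite -(subrr 0) [LHS]fB subrr.
Qed.

Lemma tensor_map_sum (A : comNzRingType) (N N' M : lmodType A)
    (f : {linear N -> N'}) (s : seq (N * M)) :
  tensor_map f (\sum_(p <- s) tens p.1 p.2) = \sum_(p <- s) tens (f p.1) p.2.
Proof.
have fB := tensor_lift_zmod (tensor_map_balanced M f).
have fD x y : @tensor_map _ _ _ M f (x + y) = tensor_map f x + tensor_map f y.
  rewrite -[y in LHS]opprK -[- y]sub0r [LHS]fB [tensor_lift _ (0 - y)]fB.
  by rewrite -!/(tensor_map f _) tensor_map0 sub0r opprK.
rewrite (big_morph (@tensor_map _ _ _ M f) fD (tensor_map0 M f)).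
by apply: eq_bigr => p _; rewrite tensor_map_tens.
Qed.

(** Let [N] be the ideal generated by the [a i] and [e i] the element [a i] of
    [N].  As [N] embeds in [A], flatness turns the relation into
    [\sum_i tens (e i) (m i) = 0] in [N] tensor [M].  Writing each element of
    [N] as a combination of the [a i] defines a map from [N * M] to [I -> M]
    that is balanced modulo the subgroup [W] of trivial families: two ways of
    writing the same element differ by a relation between the [a i].  It sends
    the sum above to [m] modulo [W]. *)
Lemma flat_equational (A : comNzRingType) (M : lmodType A) :
  flat M -> equational M.
Proof.
move=> flatM I a m am0.
have coordP (x : ideal_of a) : {c : I -> A | val x = \sum_i c i * a i}.
  by apply/cid/asboolP; exact: (valP x).
pose coord x := sval (coordP x).
have coordE x : val x = \sum_i coord x i * a i by rewrite {1}(svalP (coordP x)).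
pose b (x : ideal_of a) (v : M) : I -> M := fun i => coord x i *: v.
pose W (w : I -> M) := exists (J : finType) (c : I -> J -> A) (y : J -> M),
  (forall i, w i = \sum_j c i j *: y j) /\ (forall j, \sum_i a i * c i j = 0).
have W0 : W 0.
  exists void, (fun _ _ => 0), (fun=> 0).
  by split=> [i|[]]; rewrite big1 // => -[].
have WB x y : W x -> W y -> W (x - y).
  move=> [J [c [u [xE ac]]]] [K [d [v [yE ad]]]].
  exists (J + K)%type,
    (fun i k => match k with inl j => c i j | inr k => - d i k end),
    (fun k => match k with inl j => u j | inr k => v k end); split=> [i|[j|k]].
  - rewrite big_sumType /= -xE -[(x - y) i]/(x i - y i) yE -sumrN.
    congr (_ + _).
    by apply: eq_bigr => k _; rewrite scaleNr.
  - exact: ac.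
  - by under eq_bigr do rewrite mulrN; rewrite sumrN ad oppr0.
have WD x y : W x -> W y -> W (x + y).
  move=> Wx Wy; rewrite -[y]opprK -[- y]sub0r.
  by apply: (WB) => //; apply: (WB).
have Wrel (c : I -> A) v : \sum_i a i * c i = 0 -> W (fun i => c i *: v).
  move=> ac; exists unit, (fun i _ => c i), (fun _ => v); split=> [i|j] //.
  by rewrite big_const card_unit /= addr0.
have eP i : (a i : A^o) \in in_ideal_of a.
  apply/asboolP; exists (fun k => (k == i)%:R).
  rewrite (bigD1 i) //= eqxx mul1r big1 ?addr0 // => k /negbTE ->.
  by rewrite mul0r.
pose e i := IdealOf (eP i).
have relE i : \sum_k a k * ((k == i)%:R - coord (e i) k) = 0.
  under eq_bigr do rewrite mulrBr.
  rewrite sumrB (bigD1 i) //= eqxx mulr1 big1 ?addr0; last first.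
    by move=> k /negbTE ->; rewrite mulr0.
  under eq_bigr do rewrite mulrC.
  by rewrite -coordE subrr.
pose s := [seq (e i, m i) | i <- index_enum I].
have s0 : \sum_(p <- s) tens p.1 p.2 = 0.
  apply: (flatM (ideal_of a) A^o val val_inj).
  rewrite tensor_map_sum tensor_map0 big_map.
  under eq_bigr => i _ do rewrite /= -[a i]mulr1 [tens _ _]tensZ.
  by rewrite -tens_sumr am0 -(scale0r 0) -tensZ scale0r tens0l.
have WbE : W (\sum_(p <- s) b p.1 p.2).
  apply: tensor_sum_eq0 => // [n n' v|n v v'|k n v].
  - have -> : b (n + n') v - b n v - b n' v =
        fun i => (coord (n + n') i - coord n i - coord n' i) *: v.
      by apply/funext => i; rewrite /b !scalerBl.
    apply: Wrel; under eq_bigr do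
      rewrite !mulrBr mulrC [a _ * coord n _]mulrC [a _ * coord n' _]mulrC.
    by rewrite !sumrB -!coordE /= addrAC addrK subrr.
  - suff -> : b n (v + v') - b n v - b n v' = 0 by [].
    by apply/funext => i; rewrite /b /= !fctE scalerDr -addrA -opprD subrr.
  - have -> : b (k *: n) v - b n (k *: v) =
        fun i => (coord (k *: n) i - k * coord n i) *: v.
      apply/funext => i.
      rewrite -[LHS]/(coord _ i *: v - coord n i *: (k *: v)).
      by rewrite scalerBl scalerA mulrC.
    apply: Wrel; under eq_bigr do
      rewrite mulrBr mulrC mulrCA [a _ * coord n _]mulrC.
    by rewrite sumrB -mulr_sumr -!coordE /= subrr.
have -> : m = (\sum_(p <- s) b p.1 p.2) +
    \sum_i (fun k => ((k == i)%:R - coord (e i) k) *: m i).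
  rewrite big_map -big_split fct_sumE; apply/funext => k /=.
  rewrite (eq_bigr (fun i => (k == i)%:R *: m i)) => [|i _]; last first.
    rewrite -[LHS]/(coord (e i) k *: m i + (_ - coord (e i) k) *: m i).
    by rewrite -scalerDl subrKC.
  rewrite (bigD1 k) //= eqxx scale1r big1 ?addr0 // => i /negbTE.
  by rewrite eq_sym => ->; rewrite scale0r.
by apply: (WD) => //; apply: (big_ind W) => // i _; apply: Wrel.
Qed.

(** Finitely many relations are trivialized at once: trivialize all but one,
    rewrite the last one in terms of the resulting [y], and trivialize that.
    The vectors of [S] are carried along since later relations involve vectors
    that the earlier ones do not. *)
Lemma equational_family (A : comNzRingType) (M : lmodType A) :
    equational M ->
  forall (rels : seq (seq (A * M))) (S : seq M),
    (forall r, r \in rels -> \sum_(p <- r) p.1 *: p.2 = 0) ->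
  exists (J : finType) (b : M -> J -> A) (y : J -> M),
    (forall v, v \in S -> v = \sum_j b v j *: y j) /\
    (forall r, r \in rels -> forall j, \sum_(p <- r) p.1 * b p.2 j = 0).
Proof.
move=> eqM; elim=> [|r rels IH] S relsP.
  pose s := undup S.
  exists 'I_(size s), (fun v (j : 'I__) => (v == s`_j)%:R),
    (fun j : 'I__ => s`_j); split=> // v vS.
  have vs : v \in s by rewrite mem_undup.
  have iv : (index v s < size s)%N by rewrite index_mem.
  rewrite (bigD1 (Ordinal iv)) //= nth_index // eqxx scale1r.
  rewrite big1 ?addr0 // => j.
  rewrite -val_eqE /= => jv; case: eqP => [vE|_]; last by rewrite scale0r.
  by rewrite vE index_uniq ?undup_uniq ?eqxx in jv.
have [|J [b [y [SE relsE]]]] := IH (S ++ [seq p.2 | p <- r]).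
  by move=> q qr; apply: relsP; rewrite in_cons qr orbT.
pose a j := \sum_(p <- r) p.1 * b p.2 j.
have ay0 : \sum_j a j *: y j = 0.
  rewrite -[RHS](relsP r (mem_head _ _)).
  under eq_bigr do rewrite scaler_suml.
  rewrite exchange_big; apply: eq_big_seq => p pr /=.
  rewrite {2}(SE p.2) ?scaler_sumr; last by rewrite mem_cat map_f ?orbT.
  by apply: eq_bigr => j _; rewrite scalerA.
have [K [c [z [yE acE]]]] := eqM J a y ay0.
exists K, (fun v k => \sum_j b v j * c j k), z; split=> [v vS|q].
  rewrite [LHS]SE ?mem_cat ?vS //.
  under [RHS]eq_bigr do rewrite scaler_suml.
  rewrite exchange_big; apply: eq_bigr => j _; rewrite {1}yE scaler_sumr.
  by apply: eq_bigr => k _; rewrite scalerA.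
have sumE q' k : \sum_(p <- q') p.1 * (\sum_j b p.2 j * c j k) =
    \sum_j (\sum_(p <- q') p.1 * b p.2 j) * c j k.
  under eq_bigr do rewrite mulr_sumr.
  rewrite exchange_big; apply: eq_bigr => j _; rewrite mulr_suml.
  by apply: eq_bigr => p _; rewrite mulrA.
rewrite in_cons => /orP [/eqP ->|qr] k; rewrite sumE; first exact: acE.
by rewrite big1 // => j _; rewrite relsE ?mul0r.
Qed.

(** A formal sum of pairs [(n, v)] in [N' * M] is represented by the functional
    [phi] that maps [b : M -> A] to the sum of the [b v *: n].  If the sum is
    zero in the tensor product, finitely many relations of [M] suffice to kill
    it: [phi] vanishes on every [b] compatible with those relations.  The
    equational criterion provides compatible [b] that express the vectors at
    hand by some [y]; the vanishing then takes place in [N'], hence in [N] by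
    injectivity. *)
Lemma equational_flat (A : comNzRingType) (M : lmodType A) :
  equational M -> flat M.
Proof.
move=> eqM N N' f f_inj.
suff ker0 z : @tensor_map _ _ _ M f z = 0 -> z = 0.
  move=> x y fxy; apply/eqP; rewrite -subr_eq0; apply/eqP/ker0.
  have fB := tensor_lift_zmod (tensor_map_balanced M f).
  by rewrite [LHS]fB [X in X - _]fxy subrr.
have [s ->] := tensor_sum z; rewrite tensor_map_sum.
pose s' := [seq (f p.1, p.2) | p <- s].
have -> : \sum_(p <- s) tens (f p.1) p.2 = \sum_(p <- s') tens p.1 p.2.
  by rewrite big_map.
pose W (phi : (M -> A) -> N') := exists2 rels : seq (seq (A * M)),
  (forall r, r \in rels -> \sum_(p <- r) p.1 *: p.2 = 0) &
  forall b : M -> A, (forall r, r \in rels -> \sum_(p <- r) p.1 * b p.2 = 0) ->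
    phi b = 0.
move/(@tensor_sum_eq0 _ _ _ _ W (fun n v b => b v *: n)); case.
- by exists [::].
- move=> x y [rx rxP x0] [ry ryP y0]; exists (rx ++ ry) => [r|b bP].
    by rewrite mem_cat => /orP [/rxP|/ryP].
  rewrite -[LHS]/(x b - y b) x0 ?y0 ?subrr // => r rP; apply: bP.
    by rewrite mem_cat rP orbT.
  by rewrite mem_cat rP.
- move=> n n' v; exists [::] => // b _.
  rewrite -[LHS]/(b v *: (n + n') - b v *: n - b v *: n').
  by rewrite scalerDr -addrA -opprD subrr.
- move=> n v v'; exists [:: [:: (1, v + v'); (-1, v); (-1, v')]].
    move=> r; rewrite inE => /eqP ->.
    by rewrite !big_cons big_nil /= scale1r !scaleN1r addr0 -opprD subrr.
  move=> b /(_ _ (mem_head _ _)); rewrite !big_cons big_nil /=.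
  rewrite mul1r !mulN1r addr0 => b0.
  rewrite -[LHS]/(b (v + v') *: n - b v *: n - b v' *: n).
  by rewrite -!scalerBl -addrA b0 scale0r.
- move=> a n v; exists [:: [:: (1, a *: v); (- a, v)]].
    move=> r; rewrite inE => /eqP ->.
    by rewrite !big_cons big_nil /= scale1r scaleNr addr0 subrr.
  move=> b /(_ _ (mem_head _ _)); rewrite !big_cons big_nil /=.
  rewrite mul1r mulNr addr0 => b0.
  rewrite -[LHS]/(b v *: (a *: n) - b (a *: v) *: n) scalerA -scalerBl.
  by rewrite mulrC -opprB b0 oppr0 scale0r.
move=> rels relsP s'0.
have [J [b [y [sE relsE]]]] := equational_family eqM [seq p.2 | p <- s] relsP.
have bs0 j : \sum_(p <- s) b p.2 j *: p.1 = 0.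
  apply: f_inj; rewrite raddf_sum raddf0.
  have := s'0 (b^~ j) (fun r rr => relsE r rr j).
  rewrite fct_sumE big_map => E; rewrite -[RHS]E.
  by apply: eq_bigr => p _; exact: (linearZ_LR f).
rewrite (@eq_big_seq _ _ _ _ _ _
  (fun p => \sum_j tens (b p.2 j *: p.1) (y j))); last first.
  move=> p ps; rewrite {1}(sE p.2) ?map_f // tens_sumr.
  by apply: eq_bigr => j _; rewrite tensZ.
rewrite exchange_big big1 //= => j _.
rewrite -[RHS](tens0l N (y j)) -(bs0 j).
elim: s {s' s'0 sE bs0} => [|p s IH] /=; first by rewrite !big_nil tens0l.
by rewrite !big_cons tensDl IH.
Qed.

(** * Laurent series *)

Section LaurentTheory.
Variable R : comNzRingType.
Implicit Types f g : laurent R.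

(** A finite form of the convolution in which the range of summation depends
    only on bounds for the supports, so that it is the same for [f] and
    [theta f]. *)
Lemma lcoefM_big f g (a b n : int) (k : nat) :
    (forall i, i < a -> f i = 0) -> (forall i, i < b -> g i = 0) ->
    n < a + b + k%:Z ->
  (f * g) n = \sum_(i < k) f (a + i%:Z) * g (n - (a + i%:Z)).
Proof.
move=> Ha Hb nk; rewrite lcoefM.
pose s := [seq a + i%:Z | i <- iota 0 k].
have us : uniq s by rewrite map_inj_uniq ?iota_uniq // => x y; lia.
rewrite -(@fsbig_widen _ _ _ _ [set` s]) //; last first.
  move=> i [_ /= nis]; case: (ltP i a) => ia; first by rewrite Ha ?mul0r.
  rewrite Hb ?mulr0 //; apply: contra_notT nis => H.
  apply/mapP; exists `|i - a|%N; last by lia.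
  by rewrite mem_iota; lia.
by rewrite -fsbig_seq // /s big_map -{1}[k]subn0 -/(index_iota 0 k) big_mkord.
Qed.

Lemma lcoef_laurentCM c f n : (laurentC c * f) n = c * f n.
Proof. exact: lcoefCM. Qed.

Lemma thetaM f g : theta (f * g) = theta f * g + f * theta g.
Proof.
have [a Ha] := laurent_bound f; have [b Hb] := laurent_bound g.
have Ha' i : i < a -> theta f i = 0 by move=> /Ha /= ->; rewrite mul0rz.
have Hb' i : i < b -> theta g i = 0 by move=> /Hb /= ->; rewrite mul0rz.
apply: laurentP => n; rewrite lcoefD -[LHS]/((f * g) n *~ n).
have [k nk] : exists k : nat, n < a + b + k%:Z.
  by exists (absz (n - a - b)%R).+1; lia.
rewrite (lcoefM_big Ha Hb nk) (lcoefM_big Ha' Hb nk) (lcoefM_big Ha Hb' nk).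
rewrite -mulrzl mulr_sumr -big_split; apply: eq_bigr => i _ /=.
set j := a + _; rewrite -[f j *~ j]mulrzl -[g _ *~ _]mulrzl intrB.
by rewrite mulrA; ring.
Qed.

Lemma thetaD f g : theta (f + g) = theta f + theta g.
Proof. by apply: laurentP => n; rewrite /= mulrzDl. Qed.

Lemma lcoefX_low f k (n : int) :
  (forall i, i <= 0 -> f i = 0) -> n < k%:Z -> (f ^+ k) n = 0.
Proof.
move=> f0; elim: k n => [|k IH] n nk.
  by rewrite expr0 /= /laurentC_coef ifN //; lia.
rewrite exprS; apply: (@mul_coef_lt _ f (f ^+ k) 1 k%:Z) => [i i1|//|].
  by apply: f0; lia.
by lia.
Qed.

(** With [u = 1 - v f], which has no coefficient in degrees up to 0, the inverse
    of [v f] is the geometric series in [u].  Its coefficient in degree [n] only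
    involves the powers up to [u ^+ n], so the series may be replaced by a
    partial sum when one coefficient of the product is computed. *)
Lemma laurent_inv f (v : R) :
  (forall n, n < 0 -> f n = 0) -> v * f 0 = 1 -> exists g, g * f = 1.
Proof.
move=> f0 vf.
pose u := 1 - laurentC v * f.
have uE n : u n = (1 : laurent R) n - v * f n.
  by rewrite lcoefD lcoefN lcoef_laurentCM.
have u0 i : i <= 0 -> u i = 0.
  move=> i0; rewrite uE /= /laurentC_coef; case: eqP => [->|/eqP iN0].
    by rewrite vf subrr.
  by rewrite f0 ?mulr0 ?subr0 //; lia.
pose gc (n : int) : R := if n < 0 then 0 else \sum_(k < `|n|%N.+1) (u ^+ k) n.
have gcb : gc \in @bounded_below R.
  by apply/bounded_belowP; exists 0 => n n0; rewrite /gc n0.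
pose g := Laurent gcb.
exists (laurentC v * g); rewrite mulrC mulrA [f * _]mulrC.
have -> : laurentC v * f = 1 - u by rewrite subKr.
have sumE (s : seq nat) n : (\sum_(k <- s) u ^+ k) n = \sum_(k <- s) (u ^+ k) n.
  by elim: s => [|k s IH]; rewrite ?big_nil // !big_cons lcoefD IH.
apply: laurentP => n.
have uP i : i < 0 -> (1 - u) i = 0.
  move=> i0; rewrite lcoefD lcoefN u0 ?subr0; last by lia.
  by rewrite /= /laurentC_coef ifN //; lia.
case: (ltP n 0) => n0.
  rewrite [LHS](@mul_coef_lt _ (1 - u) g 0 0) //; last first.
    by move=> i i0; rewrite /= /gc i0.
  by rewrite /= /laurentC_coef ifN //; lia.
pose p := \sum_(0 <= k < `|n|%N.+1) u ^+ k.
have -> : ((1 - u) * g) n = ((1 - u) * p) n.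
  apply/eqP; rewrite -subr_eq0 -lcoefN -lcoefD -mulrBr.
  apply/eqP/(@mul_coef_lt _ (1 - u) (g - p) 0 (n + 1)) => //; last by lia.
  move=> i il; rewrite lcoefD lcoefN sumE /= /gc; case: ifP => i0.
    by rewrite big1_seq ?subr0 // => k _; apply: lcoefX_low => //; lia.
  rewrite -(big_mkord xpredT (fun k => (u ^+ k) i)).
  rewrite [X in _ - X](@big_cat_nat _ _ _ `|i|%N.+1) //=; last by lia.
  rewrite [X in _ - (_ + X)]big_nat_cond.
  rewrite [X in _ - (_ + X)]big1 ?addr0 ?subrr // => k.
  by move=> /andP [/andP [ik _] _]; apply: lcoefX_low => //; lia.
have -> : (1 - u) * p = 1 - u ^+ `|n|%N.+1.
  rewrite /p big_mkord -[1 - u]opprB mulNr -subrX1 opprB //.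
by rewrite lcoefD lcoefN lcoefX_low ?subr0 //; lia.
Qed.

Lemma laurent_common_bound (I : finType) (F : I -> laurent R) :
  exists N : int, forall i n, n < N -> F i n = 0.
Proof.
have /choice [N NP] i : exists N : int, forall n, n < N -> F i n = 0.
  exact: laurent_bound.
exists (- (\sum_i `|N i|%N)%:Z) => i n nN; apply: NP.
by apply: lt_le_trans nN _; rewrite (bigD1 i) //=; lia.
Qed.

Lemma lcoef_sum (I : finType) (F : I -> laurent R) n :
  (\sum_i F i) n = \sum_i F i n.
Proof. by apply: (big_morph (fun f : laurent R => f n)). Qed.

(** The coefficient vectors [c n] are chosen degree by degree; replacing them by
    0 below a common bound of the [F i] makes them Laurent series in [n]. *)
Lemma laurent_decompose (I K : finType) (s : K -> I -> R) (F : I -> laurent R) :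
    (forall n, exists c : K -> R, forall i, F i n = \sum_k c k * s k i) ->
  exists G : K -> laurent R, forall i, F i = \sum_k laurentC (s k i) * G k.
Proof.
move=> /choice [c cP]; have [N NP] := laurent_common_bound F.
have Gb k : (fun n => if n < N then 0 else c n k) \in @bounded_below R.
  by apply/bounded_belowP; exists N => n ->.
exists (fun k => Laurent (Gb k)) => i; apply: laurentP => n.
rewrite lcoef_sum; under eq_bigr do rewrite lcoef_laurentCM /=.
case: (ltP n N) => nN; first by rewrite NP // big1 // => k _; rewrite mulr0.
by rewrite cP; apply: eq_bigr => k _; rewrite mulrC.
Qed.

End LaurentTheory.

(** * Noetherian rings and descent of flatness to the coefficients *)

Section Noetherian.
Variable R : comNzRingType.
Hypothesis noethR : noetherian R.

Lemma ideal_finite_gen (I : set R) : is_ideal I ->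
  exists (K : finType) (t : K -> R), (forall k, I (t k)) /\
    forall r, I r -> exists c : K -> R, r = \sum_k c k * t k.
Proof.
move=> idI; have [s IE] := noethR idI.
exists 'I_(size s), (fun k : 'I__ => s`_k); split=> [k|r].
  rewrite IE; exists [:: (1, s`_k)]; last by rewrite big_seq1 mul1r.
  by move=> p; rewrite inE => /eqP -> /=; apply: mem_nth.
rewrite {1}IE => -[q qs ->]; elim: q qs => [|p q IH] qs.
  by exists (fun=> 0); rewrite big_nil big1 // => k _; rewrite mul0r.
have [|c cE] := IH; first by move=> p' p'q; apply: qs; rewrite in_cons p'q orbT.
have ps : p.2 \in s by exact: (qs p (mem_head _ _)).
have ip : (index p.2 s < size s)%N by rewrite index_mem.
exists (fun k : 'I__ => (if k == Ordinal ip then p.1 else 0) + c k).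
under [RHS]eq_bigr do rewrite mulrDl.
rewrite big_split -cE big_cons; congr (_ + _).
rewrite (bigD1 (Ordinal ip)) //= eqxx nth_index // big1 ?addr0 //.
by move=> k /negbTE ->; rewrite mul0r.
Qed.

Let submodule (I : finType) (W : (I -> R) -> Prop) :=
  W (fun=> 0) /\
  forall c u v, W u -> W v -> W (fun i => c * u i + v i).

Let finite_gen (I : finType) (W : (I -> R) -> Prop) :=
  exists (K : finType) (s : K -> I -> R), (forall k, W (s k)) /\
    forall w, W w -> exists c : K -> R, forall i, w i = \sum_k c k * s k i.

(** By induction on [n], generators of [W] are: vectors [u k] of [W] whose first
    coordinates generate the ideal of first coordinates of [W], and generators
    of the vectors of [W] whose first coordinate vanishes. *)
Let finite_gen_ord n (W : ('I_n -> R) -> Prop) : submodule W -> finite_gen W.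
Proof.
elim: n W => [|n IH] W [W0 WD].
  by exists void, (fun _ _ => 0); split=> [[]|w _]; exists (fun=> 0) => -[].
pose W0' (r : R) := exists2 w, W w & w ord0 = r.
have [|K [t [tW tP]]] := @ideal_finite_gen W0'.
  split; first by exists (fun=> 0).
    move=> _ _ [u Wu <-] [v Wv <-].
    exists (fun i => 1 * u i + v i); [exact: WD | by rewrite mul1r].
  move=> a _ [u Wu <-]; exists (fun i => a * u i + 0); first exact: WD Wu W0.
  by rewrite addr0.
have {tW} /choice [u uP] : forall k, exists w, W w /\ w ord0 = t k.
  by move=> k; have [w] := tW k; exists w.
pose ext (w : 'I_n -> R) i := if unlift ord0 i is Some j then w j else 0.
have [|L [s [sW sP]]] := IH (fun w => W (ext w)).
  split.
    rewrite (_ : ext _ = fun=> 0) //.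
    by apply/funext => i; rewrite /ext; case: unlift.
  move=> c v w Wv Ww.
  rewrite (_ : ext _ = fun i => c * ext v i + ext w i); first exact: WD.
  by apply/funext => i; rewrite /ext; case: unlift => //; rewrite mulr0 addr0.
exists (K + L)%type,
  (fun k => match k with inl k => u k | inr l => ext (s l) end).
split=> [[k|l]|w Ww]; [by case: (uP k) | exact: sW |].
have [c cE] : exists c : K -> R, w ord0 = \sum_k c k * t k.
  by apply: tP; exists w.
pose w1 i := w i - \sum_k c k * u k i.
have Ww1 : W w1.
  rewrite /w1; elim: (index_enum K) => [|k r IHr].
    rewrite (_ : (fun i => _) = w) //.
    by apply/funext => i; rewrite big_nil subr0.
  rewrite (_ : (fun i => _) =
    fun i => - c k * u k i + (w i - \sum_(k <- r) c k * u k i)).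
    by apply: WD => //; case: (uP k).
  by apply/funext => i; rewrite big_cons; ring.
have w10 : w1 ord0 = 0.
  rewrite /w1 cE -sumrB big1 // => k _.
  by have [_ ->] := uP k; rewrite subrr.
have [|d dE] := sP (fun j => w1 (fintype.lift ord0 j)).
  rewrite (_ : ext _ = w1) //; apply/funext => i; rewrite /ext.
  by case: unliftP => [j ->|->].
exists (fun k => match k with inl k => c k | inr l => d l end) => i.
rewrite big_sumType /=; apply/eqP; rewrite addrC -subr_eq -/(w1 i); apply/eqP.
rewrite /ext; case: unliftP => [j ->|->]; first exact: dE.
by rewrite w10 big1 // => l _; rewrite mulr0.
Qed.

Lemma noetherian_submodule (I : finType) (W : (I -> R) -> Prop) :
    W (fun=> 0) -> (forall c u v, W u -> W v -> W (fun i => c * u i + v i)) ->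
  exists (K : finType) (s : K -> I -> R), (forall k, W (s k)) /\
    forall w, W w -> exists c : K -> R, forall i, w i = \sum_k c k * s k i.
Proof.
move=> W0 WD.
have [|K [s [sW sP]]] :=
  @finite_gen_ord #|I| (fun v => W (fun i => v (enum_rank i))).
  by split=> // c u v; apply: WD.
exists K, (fun k i => s k (enum_rank i)); split=> // w Ww.
have [|c cE] := sP (fun j => w (enum_val j)).
  by rewrite (_ : (fun i => _) = w) //; apply/funext => i; rewrite enum_rankK.
by exists c => i; rewrite -cE enum_rankK.
Qed.

(** What carries the proof is the flatness of [laurent R] over [R]: solutions in
    Laurent series of a linear equation over [R] are combinations of the
    finitely many generators [s] of its solutions over [R], because each
    coefficient vector of such a solution is itself a solution. *)
Lemma equational_restrict (M : lmodType (laurent R)) :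
  equational M -> equational (restrict (@laurentC R) M).
Proof.
move=> eqM I a m am0.
have [||K [s [sa sP]]] :=
  @noetherian_submodule I (fun w => \sum_i a i * w i = 0).
- by apply: big1 => i _; rewrite mulr0.
- move=> c u v u0 v0; under eq_bigr do rewrite mulrDr mulrCA.
  by rewrite big_split /= -mulr_sumr u0 v0 mulr0 addr0.
have [J [b [y [mE ab0]]]] := eqM I (fun i => laurentC (a i)) m am0.
have /choice [G GE] j : exists G : K -> laurent R,
    forall i, b i j = \sum_k laurentC (s k i) * G k.
  apply: laurent_decompose => n; apply: sP.
  have := congr1 (fun f : laurent R => f n) (ab0 j); rewrite lcoef_sum => E.
  by rewrite -[RHS]E; apply: eq_bigr => i _; rewrite lcoef_laurentCM.
exists K, (fun i k => s k i), (fun k => \sum_j G j k *: y j); split=> // i.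
rewrite mE; under eq_bigr do rewrite GE scaler_suml.
rewrite exchange_big; apply: eq_bigr => k _.
rewrite restrict_scaleE scaler_sumr; apply: eq_bigr => j _.
by rewrite scalerA.
Qed.

End Noetherian.

(** * Complete local rings *)

Section IdealPowers.
Variables (R : comNzRingType) (m : set R).

Lemma generated_is_ideal (S : set R) : is_ideal (generated_ideal S).
Proof.
split; first by exists [::]; rewrite ?big_nil.
  move=> _ _ [s sS ->] [t tS ->]; exists (s ++ t); last by rewrite big_cat.
  by move=> p; rewrite mem_cat => /orP [/sS|/tS].
move=> a _ [s sS ->]; exists [seq (a * p.1, p.2) | p <- s].
  by move=> p /mapP [q /sS qS ->].
by rewrite mulr_sumr big_map; apply: eq_bigr => p _; rewrite mulrA.
Qed.

Lemma ideal_pow_is_ideal n : is_ideal (ideal_pow m n).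
Proof. exact: generated_is_ideal. Qed.

Lemma ideal_pow0 x : ideal_pow m 0 x.
Proof.
exists [:: (x, 1)]; last by rewrite big_seq1 mulr1.
move=> p; rewrite inE => /eqP ->.
by exists (fun=> 0); [case | rewrite big_ord0].
Qed.

Lemma ideal_powS n x y : m x -> ideal_pow m n y -> ideal_pow m n.+1 (x * y).
Proof.
move=> mx [s sS ->]; exists [seq (p.1, x * p.2) | p <- s]; last first.
  by rewrite mulr_sumr big_map; apply: eq_bigr => p _; rewrite mulrCA.
move=> _ /mapP [p /sS [a am <-] ->] /=.
exists (fun i => if unlift ord0 i is Some j then a j else x).
  by move=> i; case: unliftP.
rewrite big_ord_recl unlift_none; congr (_ * _).
by apply: eq_bigr => i _; rewrite liftK.
Qed.

Lemma ideal_powX n x : m x -> ideal_pow m n (x ^+ n).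
Proof.
move=> mx; elim: n => [|n IH]; first exact: ideal_pow0.
by rewrite exprS; apply: ideal_powS.
Qed.

Hypothesis completeR : complete_ring m.

(** Both [x] and 0 are limits of the zero sequence. *)
Lemma ideal_pow_cap x : (forall n, ideal_pow m n x) -> x = 0.
Proof.
move=> xm; have I0 n : ideal_pow m n 0 by have [] := ideal_pow_is_ideal n.
have [|l [_ lU]] := @completeR (fun=> 0); first by move=> n; rewrite subrr.
by rewrite -(lU x) ?(lU 0) // => n; rewrite subr0.
Qed.

(** The inverse is the limit of the partial sums of the geometric series. *)
Lemma one_sub_unit x : m x -> exists y, (1 - x) * y = 1.
Proof.
move=> mx; have [|l [lP _]] := @completeR (fun n => \sum_(i < n) x ^+ i).
  by move=> n; rewrite big_ord_recr /= addrC addrK; apply: ideal_powX.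
exists l; apply/eqP; rewrite -subr_eq0; apply/eqP/ideal_pow_cap => n.
have [_ ID IM] := ideal_pow_is_ideal n.
have -> : (1 - x) * l - 1 =
    (1 - x) * (l - \sum_(i < n) x ^+ i) + (-1) * x ^+ n.
  by rewrite mulrBr -[X in _ - X + _]opprK -mulNr opprB -subrX1; ring.
by apply: ID; apply: IM; [exact: lP | exact: ideal_powX].
Qed.

End IdealPowers.

Lemma local_unit (C : fieldType) (R : comAlgType C) (m : set R) (x : R) :
    is_ideal m -> complete_ring m -> residue_field_is m ->
  ~ m x -> exists y, y * x = 1.
Proof.
move=> idm completeR residueR.
have [m0 mD mM] := idm; have [c [mxc _]] := residueR x => xm.
have c0 : c != 0.
  by apply: contra_notN xm => /eqP c0; rewrite c0 scale0r subr0 in mxc.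
have [y yP] := one_sub_unit completeR (mM (- c^-1%:A) _ mxc).
exists (y * c^-1%:A); rewrite -mulrA mulrC -[RHS]yP; congr (_ * _).
rewrite mulNr opprK mulrBr -[_ * c%:A]scalerAr mulr1 scalerA divff // scale1r.
by rewrite addrC subrK.
Qed.

(** * Laurent series with coefficients in an ideal *)

Definition coef_in (R : comNzRingType) (J : set R) (f : laurent R) : Prop :=
  forall n, J (f n).

Section CoefIn.
Variables (R : comNzRingType).
Implicit Types (I J K : set R) (f g : laurent R).

Lemma coef_inM I J K f g :
  is_ideal K -> (forall x y, I x -> J y -> K (x * y)) ->
  coef_in I f -> coef_in J g -> coef_in K (f * g).
Proof.
move=> [K0 KD _] IJK fI gJ n.
have [a Ha] := laurent_bound f; have [b Hb] := laurent_bound g.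
have [k nk] : exists k : nat, n < a + b + k%:Z.
  by exists (absz (n - a - b)%R).+1; lia.
rewrite (lcoefM_big Ha Hb nk); apply: (big_ind K) => // i _.
by apply: IJK; [exact: fI | exact: gJ].
Qed.

Lemma coef_in_ideal J : is_ideal J -> is_ideal (coef_in J).
Proof.
move=> idJ; have [J0 JD JM] := idJ; split=> [n|f g fJ gJ n|f g gJ] //.
  by apply: JD; [exact: fJ | exact: gJ].
apply: (coef_inM (I := setT) (J := J)) => // x y _; exact: JM.
Qed.

Lemma ideal_sum J (L : Type) (r : seq L) (P : pred L) (F : L -> R) :
  is_ideal J -> (forall i, P i -> J (F i)) -> J (\sum_(i <- r | P i) F i).
Proof. by move=> [J0 JD _] FJ; apply: (big_ind J). Qed.

Lemma det_congr J n (A B : 'M[R]_n) : is_ideal J ->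
  (forall i j, J (A i j - B i j)) -> J (\det A - \det B).
Proof.
move=> idJ AB; have [J0 JD JM] := idJ.
rewrite /determinant -sumrB; apply: ideal_sum => // s _; rewrite -mulrBr.
apply: (JM); apply: (big_ind2 (fun x y => J (x - y))) => //.
  by rewrite subrr.
move=> x y u v xy uv.
have -> : x * u - y * v = u * (x - y) + y * (u - v) by ring.
by apply: (JD); apply: (JM).
Qed.

End CoefIn.

Section Invertible.
Variables (R : comNzRingType) (J : set R).
Hypotheses (idJ : is_ideal J).
Hypothesis unitJ : forall x : R, ~ J x -> exists y, y * x = 1.

(** Modulo [J], the series [f] starts at the first coefficient that is not in
    [J], hence is a unit; from there on [f] is a power of [x] times an
    invertible power series. *)
Lemma coef_notin_inv f : ~ coef_in J f -> exists b, coef_in J (b * f - 1).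
Proof.
move=> fJ; have [N NP] := laurent_bound f.
have idA := coef_in_ideal idJ.
have [J0 JD JM] := idJ; have [A0 AD AM] := idA.
have exk : exists k : nat, `[< ~ J (f (N + k%:Z)) >].
  move/existsNP: fJ => [n nJ]; exists (absz (n - N)%R); apply/asboolP.
  case: (ltP n N) => nN; first by rewrite NP in nJ.
  by rewrite (_ : N + _ = n) //; lia.
have [k /asboolP kJ kmin] := ex_minnP exk.
pose d := N + k%:Z.
have lob : (fun n : int => if n < d then f n else 0) \in @bounded_below R.
  by apply/bounded_belowP; exists N => n /NP ->; case: ifP.
pose lo := Laurent lob.
have loJ : coef_in J lo.
  move=> n /=; case: ifP => // nd; case: (ltP n N) => nN; first by rewrite NP.
  apply: contrapT => nJ; have := kmin (absz (n - N)%R).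
  rewrite (_ : N + _ = n); last by lia.
  by move/(_ (introT (asboolP _) nJ)); lia.
pose h := xpow R (- d) * (f - lo).
have hE n : h n = f (n + d) - lo (n + d) by rewrite lcoefXM opprK lcoefD lcoefN.
have [v vf] := unitJ kJ.
have [||g gh] := @laurent_inv R h v.
- by move=> n n0; rewrite hE /= ifT ?subrr //; lia.
- by rewrite hE /= add0r ltxx subr0.
exists (g * xpow R (- d)).
have -> : g * xpow R (- d) * f - 1 = g * xpow R (- d) * lo.
  by rewrite -gh /h; ring.
exact: AM.
Qed.

End Invertible.

(** * Endomorphisms that factor through a finite free module *)

Section FiniteRank.
Variables (A : comNzRingType) (M : lmodType A).

(** The linear maps that factor through a finite free module: [h] collects the
    coordinates of the first factor, and [e] the images of a basis under the
    second. *)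
Definition finite_rank (phi : M -> M) : Prop :=
  exists (I : finType) (h : I -> M -> A) (e : I -> M),
    (forall i, scalar (h i)) /\ forall v, phi v = \sum_i h i v *: e i.

Lemma scalar_morph (h : M -> A) : scalar h ->
  [/\ h 0 = 0, {morph h : u v / u + v} & forall c v, h (c *: v) = c * h v].
Proof.
move=> hL; have hD u v : h (u + v) = h u + h v.
  by rewrite -[u]scale1r hL scale1r mul1r.
have h0 : h 0 = 0 by apply: (addrI (h 0)); rewrite -hD !addr0.
by split=> // c v; rewrite -[c *: v]addr0 hL h0 addr0.
Qed.

Lemma finite_rankB phi psi : finite_rank phi -> finite_rank psi ->
  finite_rank (fun v => phi v - psi v).
Proof.
move=> [I [h [e [hL phiE]]]] [J [k [u [kL psiE]]]].
exists (I + J)%type,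
  (fun i => match i with inl i => h i | inr j => fun v => - k j v end),
  (fun i => match i with inl i => e i | inr j => u j end).
split=> [[i|j] a x y|v] //.
- by rewrite hL.
- by rewrite kL opprD mulrN.
rewrite big_sumType /= phiE psiE -sumrN; congr (_ + _).
by apply: eq_bigr => j _; rewrite scaleNr.
Qed.

Lemma finite_rankZ c phi : finite_rank phi -> finite_rank (fun v => c *: phi v).
Proof.
move=> [I [h [e [hL phiE]]]].
exists I, (fun i v => c * h i v), e; split=> [i a x y|v].
  by rewrite hL mulrDr mulrCA.
by rewrite phiE scaler_sumr; apply: eq_bigr => i _; rewrite scalerA.
Qed.

(** The linear forms [h j] and the vectors [e j] are a dual basis: applying each
    [h j] to a relation gives the required relations between scalars. *)
Lemma finite_rank_equational : finite_rank id -> equational M.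
Proof.
move=> [J [h [e [hL idE]]]] I a w aw0.
exists J, (fun i j => h j (w i)), e; split=> [i|j]; first exact: idE.
have [h0 hD hZ] := scalar_morph (hL j).
rewrite -[RHS]h0 -aw0 (big_morph _ hD h0); apply: eq_bigr => i _.
by rewrite hZ.
Qed.

End FiniteRank.

(** * The action of the connection *)

Section Connection.
Variables (R : comNzRingType) (M : MC R).
Let A := laurent R.
Let V := MC_module M.
Let nabla : V -> V := @MC_nabla R M.

Lemma nablaD u v : nabla (u + v) = nabla u + nabla v.
Proof.
have := @MC_linear R M 1 u v.
by rewrite !restrict_scaleE rmorph1 !scale1r.
Qed.

Lemma nabla0 : nabla 0 = 0.
Proof. by apply: (addrI (nabla 0)); rewrite -nablaD !addr0. Qed.

(** The commutator with [h(.) e] is [(theta h - h nabla)(.) e + h(.) nabla e].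
    The forms [theta \o h] and [h \o nabla] are not linear, but by the Leibniz
    rule their deviations from linearity cancel. *)
Lemma finite_rank_commutator phi :
  finite_rank phi -> finite_rank (fun v => nabla (phi v) - phi (nabla v)).
Proof.
move=> [I [h [e [hL phiE]]]].
exists (I + I)%type,
  (fun i v => match i with
    | inl i => theta (h i v) - h i (nabla v) | inr i => h i v end),
  (fun i => match i with inl i => e i | inr i => nabla (e i) end).
split=> [[i|i] a u v|v]; [ |exact: hL| ]; last first.
- rewrite big_sumType /= !phiE (big_morph _ nablaD nabla0) -sumrB -big_split /=.
  apply: eq_bigr => i _; rewrite [nabla (_ *: _)](@MC_leibniz R M) scalerBl.
  by rewrite addrAC.
have [_ hD hZ] := scalar_morph (hL i).
rewrite hL nablaD [nabla (_ *: _)](@MC_leibniz R M) !hD !hZ.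
by rewrite thetaD thetaM; ring.
Qed.

Lemma finite_rank_theta (f : A) :
  finite_rank (fun v : V => f *: v) -> finite_rank (fun v : V => theta f *: v).
Proof.
move=> /finite_rank_commutator [I [h [e [hL E]]]]; exists I, h, e; split=> // v.
by rewrite -E [nabla (_ *: _)](@MC_leibniz R M) addrK.
Qed.

(** In degree [n], [theta f + k.+1 f] is [(n + k.+1) f n]: this kills the lowest
    coefficient, of degree [- k.+1], and multiplies the constant one by the unit
    [k.+1]. *)
Lemma finite_rank_power_series (f : A) (k : nat) :
    (forall n, exists y : R, y * n.+1%:R = 1) ->
    (forall n, n < - k%:Z -> f n = 0) -> (exists y, y * f 0 = 1) ->
    finite_rank (fun v : V => f *: v) ->
  exists g : A, [/\ forall n, n < 0 -> g n = 0, exists y, y * g 0 = 1 &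
    finite_rank (fun v : V => g *: v)].
Proof.
move=> unit_nat; elim: k f => [|k IH] f f0 [y yf] ff.
  by exists f; split=> //; exists y.
pose g : A := theta f + k.+1%:R * f.
have gE n : g n = f n *~ (n + k.+1%:Z).
  rewrite /g mulr_natl lcoefD mulrzDr -pmulrn; congr (_ + _).
  by elim: k.+1 => [|j IHj]; rewrite ?mulr0n // !mulrS lcoefD IHj.
apply: (IH g).
- move=> n nk; rewrite gE; case: (eqVneq n (- k.+1%:Z)) => [->|nk'].
    by rewrite addNr mulr0z.
  by rewrite f0 ?mul0rz //; lia.
- have [z zk] := unit_nat k; exists (y * z).
  by rewrite gE add0r -pmulrn -mulr_natr mulrACA yf mul1r.
- have [I [h [e [hL E]]]] :=
    finite_rankB (finite_rank_theta ff) (finite_rankZ (- k.+1%:R) ff).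
  by exists I, h, e; split=> // v; rewrite -E scalerA -scalerBl mulNr opprK.
Qed.

Lemma finite_rank_id (f : A) :
    (forall n, exists y : R, y * n.+1%:R = 1) -> (exists y, y * f 0 = 1) ->
    finite_rank (fun v : V => f *: v) ->
  finite_rank (@id V).
Proof.
move=> unit_nat f0 ff; have [N NP] := laurent_bound f.
have [|g [g0 [y yg] fg]] :=
  @finite_rank_power_series f (absz N) unit_nat _ f0 ff.
  by move=> n nN; apply: NP; lia.
have [z zg] := laurent_inv g0 yg.
have [I [h [e [hL E]]]] := finite_rankZ z fg.
by exists I, h, e; split=> // v; rewrite -E scalerA zg scale1r.
Qed.

End Connection.

(** * A scalar close to 1 that factors through a free module *)

Section Descent.
Variables (R : comNzRingType) (m : set R) (V : lmodType (laurent R)).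
Let A := laurent R.
Variables (K : finType) (t : K -> R).
Hypotheses (idm : is_ideal m) (tm : forall k, m (t k))
  (mt : forall r, m r -> exists c : K -> R, r = \sum_k c k * t k).
Hypothesis unitm : forall x : R, ~ m x -> exists y, y * x = 1.

(** The submodule [mV] of [V]. *)
Definition in_mV (v : V) : Prop :=
  exists y : K -> V, v = \sum_k laurentC (t k) *: y k.

Lemma coef_in_decompose (a : A) : coef_in m a ->
  exists G : K -> A, a = \sum_k laurentC (t k) * G k.
Proof.
move=> am.
have [|G GE] := @laurent_decompose R unit K (fun k _ => t k) (fun=> a).
  by move=> n; have [c cE] := mt (am n); exists c.
by exists G; apply: GE tt.
Qed.

Lemma coef_in_sum (G : K -> A) : coef_in m (\sum_k laurentC (t k) * G k).
Proof.
have [_ _ mM] := idm.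
apply: ideal_sum => [|k _ n]; first exact: coef_in_ideal.
by rewrite lcoef_laurentCM mulrC; apply: mM.
Qed.

Lemma in_mV0 : in_mV 0.
Proof. by exists (fun=> 0); rewrite big1 // => k _; rewrite scaler0. Qed.

Lemma in_mVD a u v : in_mV u -> in_mV v -> in_mV (a *: u + v).
Proof.
move=> [y ->] [z ->]; exists (fun k => a *: y k + z k).
rewrite scaler_sumr -big_split; apply: eq_bigr => k _ /=.
by rewrite scalerDr !scalerA mulrC.
Qed.

Lemma in_mVZ a u : in_mV u -> in_mV (a *: u).
Proof.
by move=> mu; rewrite -[_ *: u]addr0; apply: in_mVD => //; apply: in_mV0.
Qed.

Lemma in_mV_coef a v : coef_in m a -> in_mV (a *: v).
Proof.
move=> /coef_in_decompose [G ->]; exists (fun k => G k *: v).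
by rewrite scaler_suml; apply: eq_bigr => k _; rewrite scalerA.
Qed.

Definition free_mod r (e : 'I_r -> V) : Prop :=
  forall a : 'I_r -> A, in_mV (\sum_i a i *: e i) -> forall i, coef_in m (a i).

Definition generates_mod r (e : 'I_r -> V) : Prop :=
  forall v, exists c : 'I_r -> A, in_mV (v - \sum_i c i *: e i).

(** A smallest family of generators of [V] modulo [mV] is a basis: a coefficient
    outside [m((x))] of a relation is invertible modulo [m((x))], and the
    generator that it multiplies could be omitted. *)
Lemma minimal_generators : finitely_generated V ->
  exists r (e : 'I_r -> V), generates_mod e /\ free_mod e.
Proof.
move=> [s sP].
have exr : exists r, `[< exists e : 'I_r -> V, generates_mod e >].
  exists (size s); apply/asboolP; exists (fun i : 'I__ => s`_i) => v.
  by have [c ->] := sP v; exists c; rewrite subrr; apply: in_mV0.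
have [r /asboolP [e eP] rmin] := ex_minnP exr; exists r, e; split=> // a ae i.
apply: contrapT => /(coef_notin_inv idm unitm) [b bam].
case: r e eP rmin a ae i bam => [|r] e eP rmin a ae i bam.
  by case: i {bam}.
suff : (r.+1 <= r)%N by rewrite ltnn.
apply: rmin; apply/asboolP; exists (fun j => e (fintype.lift i j)) => v.
have [c cP] := eP v.
(* Subtract from the expression of v the multiple c_i b of the relation, which
   cancels c_i e_i modulo mV. *)
exists (fun j => c (fintype.lift i j) - c i * b * a (fintype.lift i j)).
have -> : v - \sum_j (c (fintype.lift i j) - c i * b * a (fintype.lift i j)) *:
      e (fintype.lift i j) =
    c i *: (- ((b * a i - 1) *: e i)) +
      ((c i * b) *: (\sum_j a j *: e j) + (v - \sum_j c j *: e j)).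
  rewrite !(bigD1_ord i) //=.
  under eq_bigr do rewrite scalerBl -scalerA.
  rewrite sumrB -scaler_sumr; set X := \sum_j _; set Y := \sum_j _.
  rewrite scalerDr !scalerN scalerA scalerBl scale1r scalerBr !scalerA mulrA.
  set P := (_ * a i) *: _; set Q := c i *: e i; set Z := _ *: Y.
  rewrite !opprB -addrA -[P + Z + _]addrA addKr opprD.
  by rewrite [v + (- Q - X)]addrCA [Z + (- Q + _)]addrCA addNKr addrCA.
apply: in_mVD; first by rewrite -scaleN1r; apply: in_mVZ; apply: in_mV_coef.
by apply: in_mVD.
Qed.

(** The determinant trick.  For generators [g] of [V], the equations
    [g j = \sum_i d j i *: e i + \sum_l B j l *: g l] with [B] in [m((x))] give
    [(1 - B) g = d e], and multiplying by the adjugate shows that the scalar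
    [s = \det (1 - B)] maps every [g l] to the span of the [e i]. *)
Lemma nakayama r (e : 'I_r -> V) : finitely_generated V -> generates_mod e ->
  exists s : A, coef_in m (1 - s) /\
    forall v, exists c : 'I_r -> A, s *: v = \sum_i c i *: e i.
Proof.
move=> [gs gP] eP; pose p := size gs; pose g (j : 'I_p) := gs`_j.
have /choice [d dP] j : exists d : 'I_r -> A, in_mV (g j - \sum_i d i *: e i).
  exact: eP.
have /choice [B BP] j : exists B : 'I_p -> A, (forall l, coef_in m (B l)) /\
    g j - \sum_i d j i *: e i = \sum_l B l *: g l.
  have [y yE] := dP j.
  have /choice [z zP] k : exists z : 'I_p -> A, y k = \sum_l z l *: g l.
    exact: gP.
  exists (fun l => \sum_k laurentC (t k) * z k l); split=> [l|].
    exact: coef_in_sum.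
  rewrite yE; under [RHS]eq_bigr do rewrite scaler_suml.
  rewrite exchange_big; apply: eq_bigr => k _; rewrite zP scaler_sumr.
  by apply: eq_bigr => l _; rewrite scalerA.
pose T : 'M[A]_p := 1%:M - \matrix_(j, l) B j l.
have TE j : \sum_l T j l *: g l = \sum_i d j i *: e i.
  have [_ gE] := BP j; under eq_bigr do rewrite !mxE scalerBl.
  rewrite sumrB -gE (bigD1 j) //= eqxx scale1r big1 => [|l /negbTE lj].
    by rewrite addr0 subKr.
  by rewrite eq_sym lj scale0r.
exists (\det T); split.
  rewrite -(det1 A p); apply: det_congr => [|i j]; first exact: coef_in_ideal.
  by rewrite !mxE subKr; have [] := BP i.
move=> v; have [z ->] := gP v.
exists (fun i => \sum_l z l * (\sum_j (\adj T) l j * d j i)).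
have detE l : \det T *: g l = \sum_i (\sum_j (\adj T) l j * d j i) *: e i.
  under [RHS]eq_bigr do rewrite scaler_suml.
  rewrite exchange_big /=.
  transitivity (\sum_j \adj T l j *: \sum_i d j i *: e i).
    under eq_bigr do rewrite -TE scaler_sumr.
    rewrite exchange_big /= (eq_bigr (fun k => (\adj T *m T) l k *: g k)).
      rewrite mul_adj_mx (bigD1 l) //= !mxE eqxx big1 ?addr0 // => k /negbTE kl.
      by rewrite !mxE eq_sym kl scale0r.
    move=> k _; rewrite mxE scaler_suml.
    by apply: eq_bigr => j _; rewrite scalerA.
  apply: eq_bigr => j _; rewrite scaler_sumr.
  by apply: eq_bigr => i _; rewrite scalerA.
under [RHS]eq_bigr do rewrite scaler_suml.
rewrite exchange_big scaler_sumr; apply: eq_bigr => l _ /=.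
rewrite -/(g l) scalerA mulrC -scalerA detE scaler_sumr.
by apply: eq_bigr => i _; rewrite scalerA.
Qed.

Hypothesis pow_cap : forall x, (forall n, ideal_pow m n x) -> x = 0.
Hypothesis eqV : equational (restrict (@laurentC R) V).

(** By induction on [N], all coefficients of all relations are in the [N]-th
    power of [m].  Write [a j = \sum_k t k * a' j k].  The vectors
    [z k = \sum_j a' j k *: e j] satisfy the relation [\sum_k t k *: z k = 0]
    over [R], so [z k = \sum_l b k l *: y l] with [\sum_k t k * b k l = 0].
    Expressing [s *: y l] by the [e j] yields relations [kappa k] with
    [s * a i = \sum_k t k * kappa k i], which gains one power of [m]; and
    [a i - s * a i] gains one because [1 - s] is in [m((x))]. *)
Lemma lifted_free r (e : 'I_r -> V) (s : A) :
    free_mod e ->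
    coef_in m (1 - s) ->
    (forall v, exists c : 'I_r -> A, s *: v = \sum_i c i *: e i) ->
  forall a : 'I_r -> A, \sum_i a i *: e i = 0 -> forall i, a i = 0.
Proof.
move=> e_free s1 sP a ae0 i; apply: laurentP => n; apply: pow_cap => N.
move: n; rewrite -/(coef_in (ideal_pow m N) (a i)).
elim: N a ae0 i => [|N IH] a ae0 i; first by move=> n; apply: ideal_pow0.
have idN := ideal_pow_is_ideal m N.+1.
have mN := coef_inM idN (@ideal_powS _ m N).
have /choice [a' aE] j : exists G : K -> A, a j = \sum_k laurentC (t k) * G k.
  by apply: coef_in_decompose; apply: e_free; rewrite ae0; apply: in_mV0.
have [|J [b [y [zE tb0]]]] := @eqV K t (fun k => \sum_j a' j k *: e j).
  rewrite -[RHS]ae0; under [RHS]eq_bigr do rewrite aE scaler_suml.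
  rewrite exchange_big; apply: eq_bigr => k _.
  rewrite restrict_scaleE scaler_sumr.
  by apply: eq_bigr => j _; rewrite scalerA.
have /choice [c cE] l := sP (y l).
pose kappa k j := s * a' j k - \sum_l laurentC (b k l) * c l j.
have kappa0 k : \sum_j kappa k j *: e j = 0.
  under eq_bigr do rewrite scalerBl scaler_suml -scalerA.
  rewrite sumrB -scaler_sumr zE exchange_big scaler_sumr -sumrB big1 // => l _.
  rewrite restrict_scaleE scalerA mulrC -scalerA cE scaler_sumr.
  apply/eqP; rewrite subr_eq0; apply/eqP.
  by apply: eq_bigr => j _; rewrite scalerA.
have saE : s * a i = \sum_k laurentC (t k) * kappa k i.
  under eq_bigr do rewrite mulrBr.
  rewrite sumrB [X in _ - X](_ : _ = 0).
    by rewrite subr0 aE mulr_sumr; apply: eq_bigr => k _; apply: mulrCA.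
  under eq_bigr do rewrite mulr_sumr; rewrite exchange_big big1 // => l _.
  transitivity (laurentC (\sum_k t k * b k l) * c l i).
    rewrite rmorph_sum mulr_suml; apply: eq_bigr => k _.
    by rewrite rmorphM mulrA.
  by rewrite tb0 rmorph0 mul0r.
have -> : a i = s * a i + (1 - s) * a i by rewrite -mulrDl subrKC mul1r.
have [_ ND _] := coef_in_ideal idN.
apply: ND; last by apply: mN => //; apply: IH.
rewrite saE; apply: ideal_sum => [|k _]; first exact: coef_in_ideal.
move=> n; rewrite lcoef_laurentCM; apply: ideal_powS => //.
by have := IH (kappa k) (kappa0 k) i n.
Qed.

Lemma generically_free : finitely_generated V ->
  exists s : A, coef_in m (1 - s) /\ finite_rank (fun v : V => s *: v).
Proof.
move=> fgV; have [r [e [eP e_free]]] := minimal_generators fgV.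
have [s [s1 sP]] := nakayama fgV eP; exists s; split=> //.
have e0 := lifted_free e_free s1 sP.
have /choice [h hE] := sP.
exists 'I_r, (fun i v => h v i), e; split=> [i a u v|v]; last exact: hE.
apply/eqP; rewrite -subr_eq0; apply/eqP.
apply: (e0 (fun i => h (a *: u + v) i - (a * h u i + h v i))).
under eq_bigr do rewrite scalerBl scalerDl -scalerA.
rewrite sumrB big_split -scaler_sumr -!hE.
by rewrite scalerDr scalerA mulrC -scalerA subrr.
Qed.

End Descent.

(** * Flatness over the coefficients and over Laurent series *)

Theorem theorem8p18 (C : closedFieldType) (charC : [pchar C] =i pred0)
    (R : comAlgType C) (m : set R)
    (localR : local_ring m) (noethR : noetherian R)
    (completeR : complete_ring m) (residueR : residue_field_is m)
    (M : MC R) :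
  flat (MC_module M) <-> flat (restrict (@laurentC R) (MC_module M)).
Proof.
have [[idm _ _] _] := localR.
split=> [/flat_equational eqM|/flat_equational eqM].
  by apply: equational_flat; apply: equational_restrict.
have [K [t [tm mt]]] := ideal_finite_gen noethR idm.
have unitm := local_unit idm completeR residueR.
have [s [s1 sfin]] :=
  generically_free idm tm mt unitm (ideal_pow_cap completeR) eqM (MC_fg M).
apply: equational_flat; apply: finite_rank_equational.
apply: finite_rank_id sfin.
  move=> n; exists ((n.+1%:R : C)^-1%:A); rewrite mulr_algl.
  have -> : n.+1%:R = (n.+1%:R : C)%:A :> R by rewrite scaler_nat.
  by rewrite scalerA mulVf ?scale1r // (iffLR (pcharf0P C) charC).
have [y yP] := one_sub_unit completeR (s1 0).
exists y; rewrite mulrC -yP; congr (_ * _).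
by rewrite lcoefD lcoefN /= /laurentC_coef eqxx subKr.
Qed.
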